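(* Consider the general bilevel polynomial program $(P)$ described in the context, together with the Algorithm described there, run with tolerance $\epsilon\ge0$ and maximum iteration number $k_{\max}$. Assume that the minimum value $F^*$ of $(P)$ is achievable at a point $(\bar x,\bar y)$ such that $H(\bar x,\bar y,z)\ge0$ for all $z\in Z_k$ and for all $k$. Suppose $(P_k)$ and $(Q_i^k)$ are solved globally by Lasserre relaxations (that is, in every iteration the computed $F_k^*$, $S_k$, $v_i^k$, $T_i^k$ are the exact global optimal values and sets of global minimizers). (i) Assume $\epsilon=0$. If the Algorithm stops for some $k<k_{\max}$, then each $(x^*,y^* )\in\mathcal{X}^*$ is a global minimizer of $(P)$. (ii) Assume $\epsilon=0$, $k_{\max}=\infty$, and the union $\bigcup_{k\ge0}Z_k$ is bounded. Suppose the Algorithm does not stop and each $S_k\ne\emptyset$ is finite. Let $(x^*,y^* )$ be an arbitrary accumulation point of the set $\bigcup_{k\ge0}S_k$. If the value function $v(x)=\inf_{z\in Z(x)}f(x,z)$ is continuous at $x^*$, then $(x^*,y^* )$ is a global minimizer of $(P)$. (iii) Assume $k_{\max}=\infty$, the union $\bigcup_{k\ge0}Z_k$ is bounded, and the set $\Xi=\{(x,y):\psi(x,y)=0,\ \xi(x,y)\ge0\}$ is compact. Let $\Xi_1=\{x:\exists y,\ (x,y)\in\Xi\}$ be the projection of $\Xi$ onto the $x$-space, and suppose $v(x)$ is continuous on $\Xi_1$. Then, for all $\epsilon>0$, the Algorithm must terminate within finitely many steps.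
   Context: **General bilevel polynomial program.** Let $F,G_1,\dots,G_{m_1}$ be real polynomials in $(x,y)\in\mathbb{R}^n\times\mathbb{R}^p$, and let $f,g_1,\dots,g_{m_2}$ be real polynomials in $(x,z)\in\mathbb{R}^n\times\mathbb{R}^p$. Put $Z(x)=\{z\in\mathbb{R}^p:g_1(x,z)\ge0,\dots,g_{m_2}(x,z)\ge0\}$ and let $S(x)$ be the set of global minimizers of $f(x,\cdot)$ over $Z(x)$. The general bilevel polynomial program is $$(P):\quad F^*:=\min_{x\in\mathbb{R}^n,\,y\in\mathbb{R}^p}F(x,y)\quad\text{s.t.}\quad G_i(x,y)\ge0\ (i=1,\dots,m_1),\quad y\in S(x).$$ Standing assumption: $S(x)\ne\emptyset$ for every $(x,y)\in\mathcal{U}:=\{(x,y):G_i(x,y)\ge0\ (i=1,\dots,m_1),\ g_j(x,y)\ge0\ (j=1,\dots,m_2)\}$, and the feasible set of $(P)$ is nonempty. **Notation.** $H(x,y,z):=f(x,z)-f(x,y)$; $v(x):=\inf_{z\in Z(x)}f(x,z)$; $\xi(x,y):=(G_1(x,y),\dots,G_{m_1}(x,y),g_1(x,y),\dots,g_{m_2}(x,y))$. Vector inequalities are componentwise. **Jacobian polynomials $\psi$.** For $J=\{i_1,\dots,i_k\}\subseteq[m_2]=\{1,\dots,m_2\}$ with $|J|=k\le\min\{m_2,p-1\}$, let $B[J](x,z)$ be the $p\times(k+1)$ matrix with columns $\nabla_zf(x,z),\nabla_zg_{i_1}(x,z),\dots,\nabla_zg_{i_k}(x,z)$. Let $\eta^J_1,\dots,\eta^J_{\ell(J)}$,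 with $\ell(J)=p(k+1)-(k+1)^2+1$, be fixed polynomials in $(x,z)$ (constructed from the maximal minors) that define rank deficiency: they all vanish at $(x,z)$ if and only if $\operatorname{rank}B[J](x,z)\le k$. Then $\psi=(\psi_1,\dots,\psi_L)$ is the tuple of all polynomials $\eta^J_t\cdot\prod_{j\in[m_2]\setminus J}g_j$ over all such $J$ and all $t=1,\dots,\ell(J)$ (an empty product is $1$). $\psi(x,y)$ denotes $\psi$ with $z$ replaced by $y$. The common zeros of $\psi(x,\cdot)$ are exactly the Fritz John points of the lower level problem at $x$, i.e. the $z$ for which there is $(\mu_0,\dots,\mu_{m_2})\ne0$ with $\mu_0\nabla_zf(x,z)=\sum_j\mu_j\nabla_zg_j(x,z)$ and $\mu_jg_j(x,z)=0$ for all $j$. **Algorithm.** Input: the polynomials above, a tolerance $\epsilon\ge0$ and a maximum number $k_{\max}$ of iterations. Output: the set $\mathcal{X}^*$. Step 1. Let $Z_0=\emptyset$, $\mathcal{X}^*=\emptyset$, $k=0$. Step 2. Solve $$(P_k):\quad F_k^*:=\min_{x\in\mathbb{R}^n,\,y\in\mathbb{R}^p}F(x,y)\quad\text{s.t.}\quad\psi(x,y)=0,\ \xi(x,y)\ge0,\ H(x,y,z)\ge0\ (\forall z\in Z_k),$$ and get the set $S_k=\{(x_1^k,y_1^k),\dots,(x_{r_k}^k,y_{r_k}^k)\}$ of its global minimizers. Step 3. For each $i=1,\dots,r_k$: (a) solve $$(Q_i^k):\quad v_i^k:=\min_{z\in\mathbb{R}^p}H(x_i^k,y_i^k,z)\quad\text{s.t.}\quad\psi(x_i^k,z)=0,\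 g_1(x_i^k,z)\ge0,\dots,g_{m_2}(x_i^k,z)\ge0,$$ and get the set $T_i^k=\{z^k_{i,j}:j=1,\dots,t_i^k\}$ of its global minimizers; (b) if $v_i^k\ge-\epsilon$, update $\mathcal{X}^*:=\mathcal{X}^*\cup\{(x_i^k,y_i^k)\}$. Step 4. If $\mathcal{X}^*\ne\emptyset$ or $k>k_{\max}$, stop; otherwise set $Z_{k+1}:=Z_k\cup T_1^k\cup\dots\cup T_{r_k}^k$, let $k:=k+1$, and go to Step 2. *)

(* Defs.v *)
From HB Require Import structures.
From mathcomp Require Import all_boot all_order all_algebra.
From mathcomp Require Import all_classical all_reals all_analysis.
(* The notations of mpoly clash with those of mathcomp-analysis. *)
From mathcomp Require Import (canonicals) mpoly.

Set Implicit Arguments.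
Unset Strict Implicit.
Unset Printing Implicit Defensive.

Import Order.TTheory GRing.Theory Num.Theory.
Import numFieldNormedType.Exports.

Local Open Scope classical_set_scope.
Local Open Scope ring_scope.

Section Optimization.
Context {R : realType} {T : Type}.
Implicit Types (A : set T) (h : T -> R).

Definition global_minimizers A h : set T :=
  [set w | A w /\ forall w', A w' -> h w <= h w'].

(* The infimum is taken in \bar R: +oo if A is empty, -oo if h is unbounded
   below on A. *)
Definition optimal_value A h : \bar R := ereal_inf [set (h w)%:E | w in A].

End Optimization.

(* The variables of a polynomial in (x, y) or (x, z) are numbered in one block:
   first the n coordinates of x, then the p coordinates of y or z. *)
Notation poly2 R n p := (mpoly.mpoly (n + p) R).

Record bilevel (R : realType) (n p m1 m2 : nat) := Bilevel {
  upper_obj : poly2 R n p;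
  upper_con : 'I_m1 -> poly2 R n p;
  lower_obj : poly2 R n p;
  lower_con : 'I_m2 -> poly2 R n p }.

(* The number of polynomials expressing that a p x k.+1 matrix is rank
   deficient; the subtraction is not truncated as soon as k.+1 <= p. *)
Definition ell (p k : nat) : nat := (p * k.+1 - k.+1 ^ 2 + 1)%N.

Section Bilevel.
Context {R : realType} {n p m1 m2 : nat}.
Implicit Types (q : poly2 R n p) (x : 'rV[R]_n) (y z : 'rV[R]_p).
Implicit Types (w : 'rV[R]_n * 'rV[R]_p) (Z : set 'rV[R]_p).
Implicit Types (J : {set 'I_m2}) (eps : R).

Definition peval q x y : R := mpoly.meval (fun i => row_mx x y 0 i) q.

Definition grad2 q x z : 'cV[R]_p :=
  \col_i peval (mpoly.mderiv (rshift n i) q) x z.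

Variable B : bilevel R n p m1 m2.

Local Notation F := (peval (upper_obj B)).
Local Notation G i := (peval (upper_con B i)).
Local Notation f := (peval (lower_obj B)).
Local Notation g j := (peval (lower_con B j)).

Definition lower_feasible x : set 'rV[R]_p := [set z | forall j, 0 <= g j x z].

Definition lower_solutions x : set 'rV[R]_p :=
  global_minimizers (lower_feasible x) (f x).

Definition value_function x : \bar R := optimal_value (lower_feasible x) (f x).

Definition xi_ge0 x y : Prop :=
  (forall i, 0 <= G i x y) /\ (forall j, 0 <= g j x y).

Definition bilevel_feasible : set ('rV[R]_n * 'rV[R]_p) :=
  [set w | (forall i, 0 <= G i w.1 w.2) /\ lower_solutions w.1 w.2].

Definition bilevel_minimizers : set ('rV[R]_n * 'rV[R]_p) :=
  global_minimizers bilevel_feasible (fun w => F w.1 w.2).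

Definition standing_assumption : Prop :=
  (forall x y, xi_ge0 x y -> lower_solutions x !=set0) /\
  bilevel_feasible !=set0.

Definition Hfun x y z : R := f x z - f x y.

Definition jacobian J x z : 'M[R]_(p, 1 + #|J|) :=
  row_mx (grad2 (lower_obj B) x z)
         (\matrix_(i < p, j < #|J|) grad2 (lower_con B (enum_val j)) x z i 0).

Definition small J : bool := (#|J| <= minn m2 p.-1)%N.

Definition defines_rank_deficiency
    (eta : forall J : {set 'I_m2}, 'I_(ell p #|J|) -> poly2 R n p) : Prop :=
  forall J, small J -> forall x z,
    (forall t, peval (eta J t) x z = 0) <-> (\rank (jacobian J x z) <= #|J|)%N.

Variable eta : forall J : {set 'I_m2}, 'I_(ell p #|J|) -> poly2 R n p.

Definition psi J (t : 'I_(ell p #|J|)) : poly2 R n p :=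
  eta t * \prod_(j in ~: J) lower_con B j.

Definition psi_eq0 x z : Prop :=
  forall J, small J -> forall t : 'I_(ell p #|J|), peval (psi t) x z = 0.

Definition Xi : set ('rV[R]_n * 'rV[R]_p) :=
  [set w | psi_eq0 w.1 w.2 /\ xi_ge0 w.1 w.2].

Definition Xi1 : set 'rV[R]_n := [set x | exists y, Xi (x, y)].

Definition Pk_feasible Z : set ('rV[R]_n * 'rV[R]_p) :=
  [set w | [/\ psi_eq0 w.1 w.2, xi_ge0 w.1 w.2 &
               forall z, Z z -> 0 <= Hfun w.1 w.2 z]].

Definition Pk_minimizers Z : set ('rV[R]_n * 'rV[R]_p) :=
  global_minimizers (Pk_feasible Z) (fun w => F w.1 w.2).

Definition Q_feasible x : set 'rV[R]_p :=
  [set z | psi_eq0 x z /\ forall j, 0 <= g j x z].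

Definition Q_value w : \bar R :=
  optimal_value (Q_feasible w.1) (Hfun w.1 w.2).

Definition Q_minimizers w : set 'rV[R]_p :=
  global_minimizers (Q_feasible w.1) (Hfun w.1 w.2).

(* The sequences Z_k and S_k are defined for all k by the recursion of the
   algorithm with exact global solutions; the iterations actually performed are
   singled out by [reached] below. *)
Fixpoint Zk (k : nat) : set 'rV[R]_p :=
  if k is k'.+1 then
    Zk k' `|` \bigcup_(w in Pk_minimizers (Zk k')) Q_minimizers w
  else set0.

Definition Sk (k : nat) : set ('rV[R]_n * 'rV[R]_p) := Pk_minimizers (Zk k).

Definition accepted eps k : set ('rV[R]_n * 'rV[R]_p) :=
  [set w | Sk k w /\ ((- eps)%:E <= Q_value w)%E].

(* The content of the set X^* at the end of Step 3 of iteration k. *)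
Fixpoint Xstar eps (k : nat) : set ('rV[R]_n * 'rV[R]_p) :=
  (if k is k'.+1 then Xstar eps k' else set0) `|` accepted eps k.

(* The maximum number of iterations: [None] stands for infinity. *)
Implicit Type kmax : option nat.

Definition lt_kmax (k : nat) kmax : bool :=
  if kmax is Some K then (k < K)%N else true.

Definition gt_kmax (k : nat) kmax : bool :=
  if kmax is Some K then (K < k)%N else false.

Definition stop_test eps kmax k : Prop :=
  Xstar eps k !=set0 \/ gt_kmax k kmax.

Definition reached eps kmax k : Prop :=
  forall j, (j < k)%N -> ~ stop_test eps kmax j.

Definition stops_at eps kmax k : Prop :=
  reached eps kmax k /\ stop_test eps kmax k.

Definition terminates eps kmax : Prop := exists k, stops_at eps kmax k.

Definition Zunion eps kmax : set 'rV[R]_p :=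
  \bigcup_(k in [set k | reached eps kmax k]) Zk k.

Definition Sunion eps kmax : set ('rV[R]_n * 'rV[R]_p) :=
  \bigcup_(k in [set k | reached eps kmax k]) Sk k.

End Bilevel.

(* Main.v *)
Require Import Defs.
From mathcomp Require Import all_boot all_order all_algebra.
From mathcomp Require Import all_classical all_reals all_analysis.
From mathcomp Require Import (canonicals) mpoly.
From mathcomp Require Import lra.
Import Order.TTheory GRing.Theory Num.Theory.
Import numFieldNormedType.Exports.
Local Open Scope classical_set_scope.
Local Open Scope ring_scope.

Set Implicit Arguments.
Unset Strict Implicit.
Unset Printing Implicit Defensive.

(** Two facts make the algorithm work.

    The first is that a global minimizer [z] of the lower level problem at [x]
    is a zero of [psi x] ([lower_solutions_psi_eq0]).  An entry of [psi] that
    comes from [J] can be nonzero at [z] only if every constraint outside [J] is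
    inactive and the gradients of the objective and of the constraints in [J]
    are linearly independent.  Independence gives a direction along which the
    objective decreases to first order and all constraints in [J] increase, so
    [z] would not be a minimizer.  Hence the constraint [psi = 0] discards no
    feasible point of the bilevel program, each problem (Q) has the same value
    and the same minimizers as the lower level problem, and [(xbar, ybar)],
    which satisfies all cuts, is feasible for each (P_k).  So the minimum of
    (P_k) is at most the optimal value of the bilevel program, and a minimizer
    of (P_k) that is optimal for the lower level is optimal for the bilevel
    program ([le_bilevel_minimizer]); this is part (i).

    The second is that the lower level optimality gap of the iterates goes to
    zero along any accumulation point ([recurrent_gap]), as in exchange methods
    for semi-infinite programs.  Take an iterate [(x, y)] and a later one
    [(x', y')], both near the accumulation point, and let [z] be a lower
    level solution at [x].  The cut [z] is in force at [(x', y')], so that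
    [f x' y' <= f x' z].  All cuts lie in a bounded set, on which [f x'] and
    [f x] are uniformly close, and [f x' y'] is close to [f x y]; thus
    [f x y <= f x z + eps], and [f x z] is the value of the lower level at [x].

    For part (iii), an algorithm that never stops has iterates in the compact
    set [Xi], which accumulate somewhere; some iterate then has gap less than
    [eps] and passes the acceptance test.  For part (ii), the vanishing
    gap and the continuity of the value function show that the accumulation
    point is optimal for the lower level, while the remaining constraints and
    the bound on the upper objective pass to the limit. *)

(** * Evaluation of polynomials: continuity and directional derivatives *)

(** Evaluation is multiplicative, so that continuity and the derivative along a
    line can be checked on constants and variables, without exponents. *)
Lemma mpoly_ring_ind (R : comNzRingType) (n : nat)
    (P : mpoly.mpoly n R -> Prop) :
  (forall c, P (mpoly.mpolyC _ c)) ->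
  (forall i, P (mpoly.mpolyX R (mpoly.mnm1 i))) ->
  (forall q r, P q -> P r -> P (q + r)) ->
  (forall q r, P q -> P r -> P (q * r)) ->
  forall q, P q.
Proof.
move=> PC PX PD PM; apply: mpoly.mpolyind => [|c m q _ _ Pq].
  by rewrite -[0](mpoly.mpolyC0 n R).
have P1 : P 1 by rewrite -(mpoly.mpolyC1 n R).
apply: (PD) => //; rewrite -mpoly.mul_mpolyC; apply: (PM) => //.
rewrite mpoly.mpolyXE_id; apply: (big_ind P) => [//|q' r|i _]; first exact: PM.
elim: (mpoly.fun_of_multinom m i) => [|k IHk]; first by rewrite expr0.
by rewrite exprS; apply: PM.
Qed.

Lemma is_derive_meval (R : realType) (N : nat) (v e : 'I_N -> R)
    (q : mpoly.mpoly N R) :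
  is_derive (0 : R) (1 : R) (fun t => mpoly.meval (fun i => v i + t * e i) q)
    (\sum_i mpoly.meval v (mpoly.mderiv i q) * e i).
Proof.
have vE r : mpoly.meval (fun i => v i + 0 * e i) r = mpoly.meval v r.
  by apply: mpoly.meval_eq => i; rewrite mul0r addr0.
move: q; apply: mpoly_ring_ind.
- move=> c; under eq_fun do rewrite mpoly.mevalC.
  rewrite big1 => [|i _]; first exact: is_derive_cst.
  by rewrite mpoly.mderivC mpoly.meval0 mul0r.
- move=> i; under eq_fun do rewrite mpoly.mevalXU.
  rewrite (bigD1 i) //= big1 => [|j ji]; last first.
    rewrite mpoly.mderivX mpoly.mnm1E eq_sym (negPf ji).
    by rewrite scale0r mpoly.meval0 mul0r.
  rewrite mpoly.mderivX mpoly.mnm1E eqxx scale1r.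
  rewrite -{1}[mpoly.mnm1 i]mpoly.add0m mpoly.addmK.
  rewrite mpoly.mpolyX0 mpoly.meval1 mul1r addr0.
  have := is_deriveD (is_derive_cst (v i) (0 : R) (1 : R))
    (is_deriveM (is_derive_id (0 : R) (1 : R))
       (is_derive_cst (e i) (0 : R) (1 : R))).
  by rewrite /cst /= scale0r !add0r /GRing.scale /= mulr1.
- move=> q r dq dr; under eq_fun do rewrite mpoly.mevalD.
  under eq_bigr do rewrite mpoly.mderivD mpoly.mevalD mulrDl.
  by rewrite big_split; apply: is_deriveD.
- move=> q r dq dr; under eq_fun do rewrite mpoly.mevalM.
  have := is_deriveM dq dr; rewrite /= !vE.
  rewrite !scaler_sumr addrC -big_split.
  rewrite (eq_bigr (fun i => mpoly.meval v (mpoly.mderiv i (q * r)) * e i)) //.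
  move=> i _; rewrite mpoly.mderivM mpoly.mevalD !mpoly.mevalM /GRing.scale /=.
  by rewrite mulrDl !mulrA [_ * mpoly.meval v r]mulrC.
Qed.

Lemma continuous_meval (R : realType) (T : topologicalType) (N : nat)
    (u : T -> 'I_N -> R) (q : mpoly.mpoly N R) :
  (forall i, continuous (u^~ i)) -> continuous (fun s => mpoly.meval (u s) q).
Proof.
move=> cu; move: q; apply: mpoly_ring_ind.
- move=> c s; rewrite (_ : (fun _ => _) = cst c); first exact: cvg_cst.
  by apply/funext => r /=; rewrite mpoly.mevalC.
- move=> i s; rewrite (_ : (fun _ => _) = u^~ i); first exact: cu.
  by apply/funext => r /=; rewrite mpoly.mevalXU.
- move=> q r cq cr s.
  rewrite (_ : (fun _ => _) =
      (fun s => mpoly.meval (u s) q + mpoly.meval (u s) r)).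
    by apply: cvgD; [exact: cq|exact: cr].
  by apply/funext => r' /=; rewrite mpoly.mevalD.
- move=> q r cq cr s.
  rewrite (_ : (fun _ => _) =
      (fun s => mpoly.meval (u s) q * mpoly.meval (u s) r)).
    by apply: cvgM; [exact: cq|exact: cr].
  by apply/funext => r' /=; rewrite mpoly.mevalM.
Qed.

Lemma continuous_peval (R : realType) (n p : nat) (T : topologicalType)
    (a : T -> 'rV[R]_n) (b : T -> 'rV[R]_p) (q : poly2 R n p) :
  continuous a -> continuous b -> continuous (fun s => peval q (a s) (b s)).
Proof.
move=> ca cb; apply: continuous_meval => i s.
rewrite (_ : (fun _ => _) = (fun s => row_mx (a s) (b s) 0 i)) //.
case: (split_ordP i) => j ->.
  rewrite (_ : (fun _ => _) = (fun s => (a s) 0 j)); last first.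
    by apply/funext => r /=; rewrite row_mxEl.
  apply: (@continuous_comp _ _ _ a (fun M : 'rV[R]_n => M 0 j)).
    exact: ca.
  exact: coord_continuous.
rewrite (_ : (fun _ => _) = (fun s => (b s) 0 j)); last first.
  by apply/funext => r /=; rewrite row_mxEr.
apply: (@continuous_comp _ _ _ b (fun M : 'rV[R]_p => M 0 j)).
  exact: cb.
exact: coord_continuous.
Qed.

Lemma is_derive_peval_line (R : realType) (n p : nat) (q : poly2 R n p)
    (x : 'rV[R]_n) (z d : 'rV[R]_p) :
  is_derive (0 : R) (1 : R) (fun t => peval q x (z + t *: d))
    ((d *m grad2 q x z) 0 0).
Proof.
have := is_derive_meval (fun i => row_mx x z 0 i) (fun i => row_mx 0 d 0 i) q.
rewrite big_split_ord /= big1 ?add0r => [|i _]; last first.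
  by rewrite row_mxEl mxE mulr0.
rewrite (_ : (d *m _) 0 0 = \sum_(i < p) mpoly.meval
   (fun i0 => row_mx x z 0 i0) (mpoly.mderiv (rshift n i) q) *
   row_mx 0 d 0 (rshift n i)).
  congr is_derive; apply/funext => t; apply: mpoly.meval_eq => i.
  case: (split_ordP i) => j ->; rewrite ?row_mxEl ?row_mxEr !mxE //.
  by rewrite mulr0 addr0.
rewrite mxE; apply: eq_bigr => i _.
by rewrite row_mxEr mxE mulrC.
Qed.

Lemma is_derive_gt0_near (R : realType) (V : normedModType R) (h : V -> R)
    (a v : V) (l : R) :
  is_derive a v h l -> 0 < l -> \forall t \near 0^'+, h a < h (t *: v + a).
Proof.
move=> [dh dl] l0.
have c : t^-1 *: ((h \o shift a) (t *: v) - h a) @[t --> 0^'] --> l.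
  by rewrite -dl; exact: dh.
have {}c := cvgr_gt _ (cvg_dnbhs_at_right c) _ l0.
near=> t.
have t0 : 0 < t by near: t; exact: nbhs_right_gt.
have : 0 < t^-1 *: ((h \o shift a) (t *: v) - h a) by near: t; exact: c.
by rewrite /GRing.scale /= pmulr_rgt0 ?invr_gt0 // subr_gt0.
Unshelve. all: by end_near.
Qed.

Lemma peval_gt_line (R : realType) (n p : nat) (q : poly2 R n p)
    (x : 'rV[R]_n) (z d : 'rV[R]_p) :
  0 < (d *m grad2 q x z) 0 0 ->
  \forall t \near 0^'+, peval q x z < peval q x (z + t *: d).
Proof.
move=> /(is_derive_gt0_near (is_derive_peval_line q x z d)).
rewrite scale0r addr0; apply: filterS => t.
by rewrite /GRing.scale /= mulr1 addr0.
Qed.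

Lemma peval_lt_line (R : realType) (n p : nat) (q : poly2 R n p)
    (x : 'rV[R]_n) (z d : 'rV[R]_p) :
  (d *m grad2 q x z) 0 0 < 0 ->
  \forall t \near 0^'+, peval q x (z + t *: d) < peval q x z.
Proof.
have D : is_derive (0 : R) (1 : R) (fun t => - peval q x (z + t *: d))
    (- (d *m grad2 q x z) 0 0).
  exact: is_deriveN (is_derive_peval_line q x z d).
rewrite -oppr_gt0 => /(is_derive_gt0_near D).
rewrite scale0r addr0; apply: filterS => t.
by rewrite /GRing.scale /= mulr1 addr0 ltrN2.
Qed.

Lemma cvg_peval_line (R : realType) (n p : nat) (q : poly2 R n p)
    (x : 'rV[R]_n) (z d : 'rV[R]_p) :
  peval q x (z + t *: d) @[t --> 0^'+] --> peval q x z.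
Proof.
have c : continuous (fun t : R => peval q x (z + t *: d)).
  apply: continuous_peval; first by move=> t; exact: cvg_cst.
  by move=> t; apply: cvgD; [exact: cvg_cst|apply: cvgZr_tmp; exact: cvg_id].
have {c} : peval q x (z + t *: d) @[t --> (0 : R)] --> peval q x (z + 0 *: d).
  exact: c.
rewrite scale0r addr0 => c.
exact: cvg_within_filter.
Qed.

(** * First-order optimality for the lower level *)

(** A linear algebra form of the Fritz John condition: when the Jacobian of [J]
    has full column rank, the slopes of the objective and of the constraints in
    [J] can be prescribed at will, and a direction with slopes [-1] and [1]
    leads to a better feasible point. *)
Lemma lower_solutions_psi_eq0 (R : realType) (n p m1 m2 : nat)
    (B : bilevel R n p m1 m2) eta (x : 'rV[R]_n) (z : 'rV[R]_p) :
  defines_rank_deficiency B eta -> lower_solutions B x z -> psi_eq0 B eta x z.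
Proof.
move=> rkE [gz fz] J sJ t; rewrite /peval mpoly.mevalM.
have [rkJ|rkJ] := boolP (\rank (Defs.jacobian B J x z) <= #|J|)%N.
  by rewrite [X in X * _](proj2 (rkE J sJ x z) rkJ) mul0r.
have [[j jJ gj0]|inactive] :=
  pselect (exists2 j, j \notin J & peval (lower_con B j) x z = 0).
  by rewrite (bigD1 j) ?inE //= mpoly.mevalM [X in _ * (X * _)]gj0 mul0r mulr0.
exfalso.
(* The row-vector convention d *m A turns full column rank into row_full. *)
have full : row_full (Defs.jacobian B J x z).
  by rewrite /row_full eqn_leq rank_leq_col; rewrite -ltnNge in rkJ.
have /submxP[d dE] := submx_full (row_mx (-1)%:M (const_mx 1)) full.
move: dE; rewrite /Defs.jacobian mul_mx_row => /esym/eq_row_mx[df dg].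
suff : \forall t \near 0^'+, lower_feasible B x (z + t *: d) /\
    peval (lower_obj B) x (z + t *: d) < peval (lower_obj B) x z.
  by move=> /filter_ex[u [gu]]; rewrite ltNge fz.
apply: filterI; last first.
  by apply: peval_lt_line; rewrite df mxE eqxx oppr_lt0.
suff gj : forall j, \forall t \near 0^'+,
    0 <= peval (lower_con B j) x (z + t *: d).
  exact: filter_forall gj.
move=> j; have [jJ|jJ] := boolP (j \in J).
  have : \forall t \near 0^'+,
      peval (lower_con B j) x z < peval (lower_con B j) x (z + t *: d).
    apply: peval_gt_line.
    move/matrixP: dg => /(_ 0 (enum_rank_in jJ j)); rewrite !mxE => dg.
    rewrite (_ : \sum_i _ = 1) //.
    rewrite -[RHS]dg; apply: eq_bigr => i _.
    by rewrite [in RHS]mxE enum_rankK_in.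
  by apply: filterS => u /ltW; apply: le_trans; exact: gz.
have gj : 0 < peval (lower_con B j) x z.
  rewrite lt0r gz andbT; apply/eqP => gj0; apply: inactive.
  by exists j.
have : \forall t \near 0^'+, 0 < peval (lower_con B j) x (z + t *: d).
  exact: (cvgr_gt _ (cvg_peval_line _)).
by apply: filterS => u /ltW.
Qed.

(** * Uniformity on compact sets and accumulation points *)

Lemma near_compact_uniform (R : realType) (X Y : topologicalType)
    (h : X * Y -> R) (K : set Y) (x0 : X) (e : R) :
  continuous h -> compact K -> 0 < e ->
  \forall x \near x0, forall y, K y -> `|h (x0, y) - h (x, y)| < e.
Proof.
move=> ch /compact_near_coveringP cK e0.
apply: (cK X (nbhs x0) (fun x y => `|h (x0, y) - h (x, y)| < e)) => y _.
pose gap (s : Y * X) := h (x0, s.1) - h (s.2, s.1).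
have cgap : gap s @[s --> (y, x0)] --> gap (y, x0).
  apply: cvgB.
    apply: (@cvg_comp _ _ _ (fun s : Y * X => (x0, s.1)) h _ (nbhs (x0, y))).
      by apply: cvg_pair; [exact: cvg_cst|exact: cvg_fst].
    exact: ch.
  apply: (@cvg_comp _ _ _ (fun s : Y * X => (s.2, s.1)) h _ (nbhs (x0, y))).
    by apply: cvg_pair; [exact: cvg_snd|exact: cvg_fst].
  exact: ch.
have g0 : gap (y, x0) = 0 by rewrite /gap subrr.
rewrite g0 in cgap.
have := cvgr0_norm_lt _ cgap _ e0.
exact.
Qed.

Lemma bounded_sub_compact (R : realType) (p : nat) (A : set 'rV[R]_p) :
  bounded_set A -> exists2 K, compact K & A `<=` K.
Proof.
move=> [M [_ AM]]; exists [set z | `|z| <= M + 1]; last first.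
  by move=> z Az; apply: (AM (M + 1)) => //; rewrite ltrDl.
have bK : bounded_set [set z : 'rV[R]_p | `|z| <= M + 1].
  exists (M + 1); split; first exact: num_real.
  by move=> N MN z /= zM; apply: le_trans zM (ltW MN).
have clK : closed ((fun z : 'rV[R]_p => `|z|) @^-1` [set t | t <= M + 1]).
  apply: preimage_closed => [z _|]; first exact: norm_continuous.
  exact: closed_le.
exact: (bounded_closed_compact bK clK).
Qed.

Lemma closed_continuous_ge0 (R : realType) (T : topologicalType) (h : T -> R) :
  continuous h -> closed [set s | 0 <= h s].
Proof.
move=> ch; apply: (@preimage_closed _ _ h [set t | 0 <= t]) => [s _|].
  exact: ch.
exact: closed_ge.
Qed.

(** Removing finitely many finite sets from the union does not destroy a limit
    point, since a finite set is closed. *)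
Lemma limit_point_tail (T : topologicalType) (S : nat -> set T) (a : T)
    (N : nat) (U : set T) :
  accessible_space T -> (forall k, finite_set (S k)) ->
  limit_point (\bigcup_k S k) a -> nbhs a U ->
  exists k w, [/\ (N <= k)%N, S k w & U w].
Proof.
move=> /accessible_finite_set_closed T1 finS aS aU.
pose A := \bigcup_(k in `I_N) S k.
have finA : finite_set (A `\ a).
  by apply: finite_setD; apply: bigcup_finite => // k _.
have nA : nbhs a (~` (A `\ a)).
  apply: open_nbhs_nbhs; split; last by move=> [_ /(_ erefl)].
  by apply: closed_openC; exact: T1.
have [w [/eqP wa [k _ Sw] [Uw Aw]]] := aS _ (filterI aU nA).
exists k, w; split => //; rewrite leqNgt; apply/negP => kN.
by apply: Aw; split => //; exists k.
Qed.

(** * The problems solved by the algorithm *)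

Section Algorithm.
Context {R : realType} {n p m1 m2 : nat}.
Variable B : bilevel R n p m1 m2.
Variable eta : forall J : {set 'I_m2}, 'I_(ell p #|J|) -> poly2 R n p.
Hypothesis eta_rank : defines_rank_deficiency B eta.
Hypothesis standing : standing_assumption B.

Local Notation F := (peval (upper_obj B)).
Local Notation f := (peval (lower_obj B)).

Lemma lower_solutions_Q_feasible x :
  lower_solutions B x `<=` Q_feasible B eta x.
Proof.
by move=> z zS; split; [exact: lower_solutions_psi_eq0|exact: zS.1].
Qed.

Lemma lower_solution_value x z : lower_solutions B x z ->
  value_function B x = (f x z)%:E.
Proof.
move=> [gz fz]; apply/eqP; rewrite eq_le; apply/andP; split.
  by apply: ereal_inf_lbound; exists z.
by apply: le_ereal_inf_tmp => _ [z' gz' <-]; rewrite lee_fin fz.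
Qed.

Lemma lower_solutions_Q_minimizers w :
  lower_solutions B w.1 `<=` Q_minimizers B eta w.
Proof.
move=> z zS; split; first exact: lower_solutions_Q_feasible.
by move=> z' [_ gz']; rewrite lerD2r zS.2.
Qed.

Lemma Q_value_lower_solution w z : lower_solutions B w.1 z ->
  Q_value B eta w = (f w.1 z - f w.1 w.2)%:E.
Proof.
move=> zS; apply/eqP; rewrite eq_le; apply/andP; split.
  by apply: ereal_inf_lbound; exists z => //; exact: lower_solutions_Q_feasible.
by apply: le_ereal_inf_tmp => _ [z' [_ gz'] <-]; rewrite lee_fin lerD2r zS.2.
Qed.

Lemma bilevel_feasible_Pk_feasible x y k :
  bilevel_feasible B (x, y) ->
  (forall z, Zk B eta k z -> 0 <= Hfun B x y z) ->
  Pk_feasible B eta (Zk B eta k) (x, y).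
Proof.
move=> [Gxy Sxy] Hz; split => //=; first exact: lower_solutions_psi_eq0.
by split => //; exact: Sxy.1.
Qed.

(** Comparing [y] with the solutions of the lower level suffices, because the
    standing assumption provides at least one and it bounds all other feasible
    values from below. *)
Lemma le_bilevel_minimizer x y xb yb :
  bilevel_minimizers B (xb, yb) -> xi_ge0 B x y ->
  (forall z, lower_solutions B x z -> f x y <= f x z) ->
  F x y <= F xb yb -> bilevel_minimizers B (x, y).
Proof.
move=> [_ Fmin] xi fle Fle; split => /=; last first.
  by move=> w /Fmin; exact: le_trans.
split=> /=; first exact: xi.1.
have [z zS] := standing.1 x y xi.
split; first exact: xi.2.
by move=> z' gz'; apply: (le_trans (fle z zS)); exact: zS.2.
Qed.

Lemma Zk_mono k l : (k <= l)%N -> Zk B eta k `<=` Zk B eta l.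
Proof.
move=> /subnK <-; elim: (l - k)%N => [|d IHd] z Zz //.
by rewrite addSn; left; exact: IHd.
Qed.

Lemma Q_minimizers_Zk k l w z : (k < l)%N -> Sk B eta k w ->
  Q_minimizers B eta w z -> Zk B eta l z.
Proof. by move=> kl Sw Qz; apply: (Zk_mono kl); right; exists w. Qed.

Lemma not_terminates_reached eps kmax k :
  ~ terminates B eta eps kmax -> reached B eta eps kmax k.
Proof.
move=> nt; elim/ltn_ind: k => k IHk j jk sj.
by apply: nt; exists j; split => //; exact: IHk.
Qed.

(** The algorithm stops as soon as a point is accepted, so that nothing was
    collected in earlier iterations. *)
Lemma Xstar_accepted eps kmax k w : stops_at B eta eps kmax k ->
  Xstar B eta eps k w -> accepted B eta eps k w.
Proof.
case: k => [_ [//|//]|k [rk _] [Xw|//]].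
by case: (rk k (ltnSn k)); left; exists w.
Qed.

Lemma Sk_lower_solution k w : Sk B eta k w -> lower_solutions B w.1 !=set0.
Proof. by case=> -[_ xi _] _; exact: standing.1 xi. Qed.

(** The recurrence hypothesis says that [a] is an accumulation point of the
    iterates however late they start; it covers both limit points of the union
    of the [Sk] and cluster points of a sequence of iterates.  The cut added for
    [w] at step [k] is in force at a later iterate [w'] close to [w], where it
    bounds the gap; uniform continuity of the objective over the bounded set of
    cuts carries this bound back to [w]. *)
Lemma recurrent_gap (eps : R) (Zs : set 'rV[R]_p)
    (a : 'rV[R]_n * 'rV[R]_p) (U : set ('rV[R]_n * 'rV[R]_p)) :
  bounded_set Zs -> (forall k, Zk B eta k `<=` Zs) ->
  (forall N V, nbhs a V -> exists k w, [/\ (N <= k)%N, Sk B eta k w & V w]) ->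
  0 < eps -> nbhs a U ->
  exists k w z, [/\ Sk B eta k w, U w, lower_solutions B w.1 z &
                  f w.1 w.2 < f w.1 z + eps].
Proof.
move=> bZ ZZs rec eps0 aU.
have [K cK ZsK] := bounded_sub_compact bZ.
(* Each of w and w' adds an error in f _ z and one in f at the iterate. *)
have e0 : 0 < eps / 4 by lra.
pose V := [set w | (forall z, K z -> `|f a.1 z - f w.1 z| < eps / 4) /\
  `|f a.1 a.2 - f w.1 w.2| < eps / 4].
have aV : nbhs a V.
  apply: filterI.
    have : \forall x \near a.1, forall z, K z -> `|f a.1 z - f x z| < eps / 4.
      apply: (near_compact_uniform (h := fun s => f s.1 s.2)) => //.
      by apply: continuous_peval => s; [exact: cvg_fst|exact: cvg_snd].
    exact: (@cvg_fst _ _ (nbhs a.1) (nbhs a.2)).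
  have c : f w.1 w.2 @[w --> a] --> f a.1 a.2.
    by apply: continuous_peval => s; [exact: cvg_fst|exact: cvg_snd].
  exact: (cvgr_dist_lt _ _ c _ e0).
have [k [w [_ Sw [Uw [wf1 wf2]]]]] := rec 0%N _ (filterI aU aV).
have [l [w' [kl Sw' [w'f1 w'f2]]]] := rec k.+1 _ aV.
have [z zS] := Sk_lower_solution Sw.
have Zz : Zk B eta l z.
  exact: Q_minimizers_Zk kl Sw (lower_solutions_Q_minimizers zS).
have Kz : K z by apply: ZsK; exact: ZZs Zz.
exists k, w, z; split => //.
have [[_ _ Hw'] _] := Sw'.
have := Hw' z Zz; rewrite /Hfun subr_ge0 => le1.
move: (wf1 z Kz) (w'f1 z Kz) wf2 w'f2; rewrite !ltr_norml.
move=> /andP[? ?] /andP[? ?] /andP[? ?] /andP[? ?].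
lra.
Qed.

(** The feasible set of (P_k) is cut out of the compact set [Xi] by closed
    conditions. *)
Lemma Sk_nonempty k xb yb : compact (Xi B eta) ->
  Pk_feasible B eta (Zk B eta k) (xb, yb) -> Sk B eta k !=set0.
Proof.
move=> cXi feas.
have cA : compact (Pk_feasible B eta (Zk B eta k)).
  have -> : Pk_feasible B eta (Zk B eta k) = Xi B eta `&`
      \bigcap_(z in Zk B eta k) [set w | 0 <= Hfun B w.1 w.2 z].
    apply/seteqP; split => w; first by case.
    by case=> -[].
  apply: (compact_closedI cXi); apply: closed_bigI => z _.
  apply: closed_continuous_ge0 => w; apply: cvgB.
    by apply: continuous_peval => s; [exact: cvg_fst|exact: cvg_cst].
  by apply: continuous_peval => s; [exact: cvg_fst|exact: cvg_snd].
have [||c] := @compact_EVT_min _ R (fun w => F w.1 w.2) _ _ cA.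
- by exists (xb, yb).
- apply: continuous_subspaceT.
  by apply: continuous_peval => s; [exact: cvg_fst|exact: cvg_snd].
- rewrite inE => cP cmin; exists c; split => // w wP.
  by apply: cmin; rewrite inE.
Qed.

End Algorithm.

(** * Convergence of the algorithm *)

Theorem theorem4p3 (R : realType) (n p m1 m2 : nat)
    (n_gt0 : (0 < n)%N) (p_gt0 : (0 < p)%N)
    (B : bilevel R n p m1 m2)
    (eta : forall J : {set 'I_m2}, 'I_(ell p #|J|) -> poly2 R n p)
    (eta_rank : defines_rank_deficiency B eta)
    (standing : standing_assumption B)
    (eps : R) (eps_ge0 : 0 <= eps) (kmax : option nat)
    (xbar : 'rV[R]_n) (ybar : 'rV[R]_p)
    (bar_min : bilevel_minimizers B (xbar, ybar))
    (bar_H : forall k, reached B eta eps kmax k ->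
       forall z, Zk B eta k z -> 0 <= Hfun B xbar ybar z) :
  [/\
      eps = 0 ->
      forall k, lt_kmax k kmax -> stops_at B eta eps kmax k ->
      forall w, Xstar B eta eps k w -> bilevel_minimizers B w,
      eps = 0 -> kmax = None ->
      bounded_set (Zunion B eta eps kmax) ->
      ~ terminates B eta eps kmax ->
      (forall k, Sk B eta k !=set0 /\ finite_set (Sk B eta k)) ->
      forall (xs : 'rV[R]_n) (ys : 'rV[R]_p),
      limit_point (Sunion B eta eps kmax) (xs, ys) ->
      {for xs, continuous (value_function B)} ->
      bilevel_minimizers B (xs, ys) &
      kmax = None ->
      bounded_set (Zunion B eta eps kmax) ->
      compact (Xi B eta) ->
      {within Xi1 B eta, continuous (value_function B)} ->
      0 < eps -> terminates B eta eps kmax].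
Proof.
split.
- move=> e0 k _ stop w /(Xstar_accepted stop)[[[_ xi HZ] Fmin] Qge].
  have [rk _] := stop.
  case: w xi HZ Fmin Qge => x y /= xi HZ Fmin Qge.
  apply: (le_bilevel_minimizer standing bar_min xi) => [z zS|].
    move: Qge; rewrite (Q_value_lower_solution eta_rank (w := (x, y)) zS).
    by rewrite e0 oppr0 lee_fin subr_ge0.
  apply: (Fmin (xbar, ybar)).
  by apply: (bilevel_feasible_Pk_feasible eta_rank bar_min.1); exact: bar_H rk.
- move=> e0 kN bZ nt Sfin xs ys lim cv.
  have reach k : reached B eta eps kmax k := not_terminates_reached nt.
  have SE : Sunion B eta eps kmax = \bigcup_k Sk B eta k.
    by apply/seteqP; split => w [k _ Sw]; exists k => //; exact: reach.
  have acc (h : 'rV[R]_n * 'rV[R]_p -> R) : continuous h ->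
      (forall k w, Sk B eta k w -> 0 <= h w) ->
      0 <= h (xs, ys).
    move=> ch Sh; apply: (closed_continuous_ge0 ch).
    apply: closure_subset (subset_limit_point lim) => w [k _]; exact: Sh.
  have cq (q : poly2 R n p) : continuous (fun w => peval q w.1 w.2).
    by apply: continuous_peval => s; [exact: cvg_fst|exact: cvg_snd].
  have xi : xi_ge0 B xs ys.
    split=> i.
      by apply: (acc _ (cq (upper_con B i))) => k w [[_ [Gw _] _] _]; exact: Gw.
    by apply: (acc _ (cq (lower_con B i))) => k w [[_ [_ gw] _] _]; exact: gw.
  apply: (le_bilevel_minimizer standing bar_min xi) => [z zS|]; last first.
    rewrite -subr_ge0.
    apply: (acc (fun w =>
      peval (upper_obj B) xbar ybar - peval (upper_obj B) w.1 w.2)).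
      by move=> w; apply: cvgB; [exact: cvg_cst|exact: cq].
    move=> k w [_ Fmin]; rewrite subr_ge0; apply: (Fmin (xbar, ybar)).
    by apply: (bilevel_feasible_Pk_feasible eta_rank bar_min.1); exact: bar_H.
  (* One third of e is spent on moving f from (xs, ys) to an iterate w, one on
     the gap of w, and one on moving the value function from w.1 back to xs. *)
  apply/ler_addgt0Pr => e e_gt0.
  have e3 : 0 < e / 3 by lra.
  pose U := [set w : 'rV[R]_n * 'rV[R]_p |
    (value_function B w.1 < (peval (lower_obj B) xs z + e / 3)%:E)%E /\
    `|peval (lower_obj B) xs ys - peval (lower_obj B) w.1 w.2| < e / 3].
  have aU : nbhs (xs, ys) U.
    apply: filterI; last first.
      exact: (cvgr_dist_lt _ _ (cq (lower_obj B) (xs, ys)) _ e3).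
    have vle : \forall x \near xs,
        (value_function B x < (peval (lower_obj B) xs z + e / 3)%:E)%E.
      apply: (cv [set v | (v < (peval (lower_obj B) xs z + e / 3)%:E)%E]).
      rewrite (lower_solution_value zS).
      by apply: (@nbhs_open_ereal_lt R _ (fun r => r + e / 3)); rewrite ltrDl.
    exact: (@cvg_fst _ _ (nbhs xs) (nbhs ys) _ _ vle).
  have rec N V : nbhs (xs, ys) V ->
      exists k w, [/\ (N <= k)%N, Sk B eta k w & V w].
    apply: limit_point_tail => [|k|]; last by rewrite -SE.
      by apply: hausdorff_accessible; exact: norm_hausdorff.
    by case: (Sfin k).
  have ZZ k : Zk B eta k `<=` Zunion B eta eps kmax.
    by move=> u; exists k => //; exact: reach.
  have [k [w [u [Sw [vw fw] uS gap]]]] :=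
    recurrent_gap eta_rank standing bZ ZZ rec e3 aU.
  move: vw fw gap; rewrite (lower_solution_value uS) lte_fin ltr_norml.
  by move=> ? /andP[? ?] ?; lra.
- move=> kN bZ cXi _ e_gt0; apply: contrapT => nt.
  have reach k : reached B eta eps kmax k := not_terminates_reached nt.
  have Sne k : Sk B eta k !=set0.
    apply: (Sk_nonempty cXi (xb := xbar) (yb := ybar)).
    by apply: (bilevel_feasible_Pk_feasible eta_rank bar_min.1); exact: bar_H.
  have [w Sw] := choice Sne.
  have [a [_ aw]] : (Xi B eta `&` cluster (w @ \oo)) !=set0.
    apply: cXi; exists 0%N => // k _ /=.
    by have [[]] := Sw k.
  have rec N V : nbhs a V -> exists k w, [/\ (N <= k)%N, Sk B eta k w & V w].
    move=> aV.
    have wN : (w @ \oo) [set s | exists2 k, (N <= k)%N & s = w k].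
      by exists N => // k /= Nk; exists k.
    have [_ [[k Nk ->] Vk]] := aw _ _ wN aV.
    by exists k, (w k).
  have ZZ k : Zk B eta k `<=` Zunion B eta eps kmax.
    by move=> u; exists k => //; exact: reach.
  have [k [s [u [Ss _ uS gap]]]] :=
    recurrent_gap eta_rank standing bZ ZZ rec e_gt0 filterT.
  case: (reach k.+1 k (ltnSn k)); left; exists s.
  suff acck : accepted B eta eps k s by case: {+}k acck => [|k'] acck; right.
  split => //; rewrite (Q_value_lower_solution eta_rank uS) lee_fin.
  by lra.
Qed.
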